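(* Let $\kappa$ be a regular uncountable cardinal and suppose $\mathrm{P}_{14}(\kappa,\sqsubseteq,1,\{\kappa\})$ holds. Then there exists a downward-closed subtree $T\subseteq{}^{<\kappa}\kappa$ which, ordered by proper inclusion, is a prolific slim $\kappa$-Souslin tree admitting an injective $\mathcal F^{\mathrm{fin}}_{\aleph_0}$-ascent path.
   Context: For a downward-closed $T\subseteq{}^{<\kappa}\kappa$ ordered by $\subsetneq$, the height of $t$ is $\mathrm{dom}(t)$ and $T_\alpha=T\cap{}^\alpha\kappa$. $T$ is prolific if for every $\alpha<\kappa$ and $x\in T_\alpha$, $x^\frown\langle i\rangle\in T$ for all $i<\max\{\omega,\alpha\}$; slim if $|T_\alpha|\le\max\{|\alpha|,\aleph_0\}$ for all $\alpha$; $\kappa$-Souslin if it has height $\kappa$, levels of size $<\kappa$, no cofinal branch and no antichain of size $\kappa$. $\mathcal F^{\mathrm{fin}}_{\aleph_0}=\{Z\subseteq\omega\mid\omega\setminus Z$ finite$\}$. An $\mathcal F^{\mathrm{fin}}_{\aleph_0}$-ascent path is $\langle f_\alpha\mid\alpha<\kappa\rangle$ with $f_\alpha:\omega\to T_\alpha$ and $\{n\mid f_\alpha(n)\subsetneq f_\beta(n)\}\in\mathcal F^{\mathrm{fin}}_{\aleph_0}$ for $\alpha<\beta<\kappa$; it is injective if some $f_\alpha\restriction I$ is injective with $I\in\mathcal F^{\mathrm{fin}}_{\aleph_0}$. Proxy principle: $\mathrm{acc}(D)=\{\alpha\in D\mid\sup(D\cap\alpha)=\alpha>0\}$, $\mathrm{succ}_\omega(D)=\{\delta\in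 D\mid0<\mathrm{otp}(D\cap\delta)<\omega\}$; $D\sqsubseteq C$ iff $D=C\cap\beta$ for some $\beta$. $\mathrm{P}^-_{14}(\kappa,\mathcal R,\mu,\mathcal S)$ (for a binary relation $\mathcal R$, cardinal $1\le\mu\le\kappa$, nonempty family $\mathcal S$ of stationary subsets of $\kappa$) asserts the existence of $\langle C_\alpha\mid\alpha<\kappa\rangle$ with: $C_\alpha$ club in $\alpha$ for limit $\alpha$; $C_{\bar\alpha}\mathrel{\mathcal R}C_\alpha$ whenever $\bar\alpha\in\mathrm{acc}(C_\alpha)$; for every sequence $\langle A_i\mid i<\mu\rangle$ of cofinal subsets of $\kappa$ and $S\in\mathcal S$, stationarily many $\alpha\in S$ satisfy $\sup\{\beta\in C_\alpha\mid\mathrm{succ}_\omega(C_\alpha\setminus\beta)\subseteq A_i\}=\alpha$ for all $i<\min\{\alpha,\mu\}$. $\mathrm{P}_{14}(\kappa,\mathcal R,\mu,\mathcal S)$ means $\mathrm{P}^-_{14}(\kappa,\mathcal R,\mu,\mathcal S)$ together with $\diamondsuit(\kappa)$. *)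

(* Defs.v *)
(* A regular uncountable cardinal kappa is modelled as a type K
   carrying a strict well-order ltK of order type kappa (an initial ordinal).
   Ordinals alpha < kappa are the elements of K; ^alpha kappa is seg alpha -> K. *)
From Stdlib Require Import List.
Set Implicit Arguments.

Section Kappa.
Variable K : Type.
Variable ltK : K -> K -> Prop.

Definition leK (x y : K) := ltK x y \/ x = y.

Definition card_le (A B : Type) : Prop := exists f : A -> B, forall x y, f x = f y -> x = y.
Definition card_lt (A B : Type) : Prop := card_le A B /\ ~ card_le B A.

Definition seg (a : K) : Type := {b : K | ltK b a}.

Definition strict_well_order : Prop :=
  (forall x, ~ ltK x x) /\
  (forall x y z, ltK x y -> ltK y z -> ltK x z) /\
  (forall x y, ltK x y \/ x = y \/ ltK y x) /\
  well_founded ltK.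

Definition bounded (X : K -> Prop) : Prop := exists a, forall x, X x -> ltK x a.

Definition regular_uncountable_cardinal : Prop :=
  strict_well_order /\
  (forall a, ~ card_le K (seg a)) /\
  (forall X : K -> Prop, card_lt {x | X x} K -> bounded X) /\
  ~ card_le K nat.

Definition pos (a : K) : Prop := exists b, ltK b a.

Definition sup_eq (X : K -> Prop) (a : K) : Prop :=
  (forall x, X x -> leK x a) /\ (forall g, ltK g a -> exists x, X x /\ ltK g x).

Definition inter_below (D : K -> Prop) (a : K) : K -> Prop := fun x => D x /\ ltK x a.

Definition acc (D : K -> Prop) (a : K) : Prop := D a /\ pos a /\ sup_eq (inter_below D a) a.

Definition is_limit (a : K) : Prop :=
  pos a /\ forall b, ltK b a -> exists g, ltK b g /\ ltK g a.

Definition club_in (C : K -> Prop) (a : K) : Prop :=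
  (forall x, C x -> ltK x a) /\ sup_eq C a /\
  (forall g, ltK g a -> pos g -> sup_eq (inter_below C g) g -> C g).

Definition club (C : K -> Prop) : Prop :=
  (forall b, exists c, C c /\ ltK b c) /\
  (forall g, pos g -> sup_eq (inter_below C g) g -> C g).

Definition stationary (S : K -> Prop) : Prop := forall C, club C -> exists a, C a /\ S a.

Definition cofinal (A : K -> Prop) : Prop := forall b, exists a, A a /\ ltK b a.

Definition sqsub (D C : K -> Prop) : Prop := exists b, forall x, D x <-> (C x /\ ltK x b).

Definition finite_set (X : K -> Prop) : Prop := exists l : list K, forall x, X x -> In x l.

(* succ_omega(D) = {d in D | 0 < otp(D ∩ d) < omega} *)
Definition succ_omega (D : K -> Prop) : K -> Prop :=
  fun d => D d /\ (exists x, inter_below D d x) /\ finite_set (inter_below D d).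

Definition setminus_ord (C : K -> Prop) (b : K) : K -> Prop := fun x => C x /\ ~ ltK x b.

Definition P14_minus_sq_1_kappa : Prop :=
  exists C : K -> K -> Prop,
    (forall a, is_limit a -> club_in (C a) a) /\
    (forall a ab, acc (C a) ab -> sqsub (C ab) (C a)) /\
    (forall A : K -> Prop, cofinal A ->
       stationary (fun a =>
         (* for all i < min{a, 1}, i.e. if 0 < a *)
         pos a ->
         sup_eq (fun b => C a b /\ (forall x, succ_omega (setminus_ord (C a) b) x -> A x)) a)).

Definition diamond : Prop :=
  exists Z : K -> K -> Prop,
    (forall a x, Z a x -> ltK x a) /\
    forall X : K -> Prop, stationary (fun a => forall x, Z a x <-> (X x /\ ltK x a)).

Definition P14_sq_1_kappa : Prop := P14_minus_sq_1_kappa /\ diamond.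

Definition node : Type := {a : K & seg a -> K}.
Definition height (t : node) : K := projT1 t.

Definition psub (t u : node) : Prop :=
  ltK (height t) (height u) /\
  forall b (h1 : ltK b (height t)) (h2 : ltK b (height u)),
    projT2 t (exist _ b h1) = projT2 u (exist _ b h2).

Definition downward_closed (T : node -> Prop) : Prop :=
  forall t u, T u -> psub t u -> T t.

Definition level (T : node -> Prop) (a : K) : Type := {t : node | T t /\ height t = a}.

Definition lt_omega (i : K) : Prop := exists l : list K, forall j, ltK j i -> In j l.

Definition is_successor (a b : K) : Prop := ltK a b /\ forall g, ltK a g -> ~ ltK g b.

Definition extends_by (x u : node) (i : K) : Prop :=
  is_successor (height x) (height u) /\ psub x u /\
  exists h : ltK (height x) (height u), projT2 u (exist _ (height x) h) = i.

Definition prolific (T : node -> Prop) : Prop :=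
  forall a x, T x -> height x = a ->
    forall i, (lt_omega i \/ ltK i a) -> exists u, T u /\ extends_by x u i.

(* |T_a| <= max{|a|, aleph_0} = |a + omega| *)
Definition slim (T : node -> Prop) : Prop := forall a, card_le (level T a) (seg a + nat).

Definition souslin (T : node -> Prop) : Prop :=
  (forall a, exists t, T t /\ height t = a) /\
  (forall a, card_lt (level T a) K) /\
  (~ exists B : node -> Prop,
       (forall t, B t -> T t) /\
       (forall t u, B t -> B u -> t = u \/ psub t u \/ psub u t) /\
       (forall a, exists t, B t /\ height t = a)) /\
  (~ exists A : node -> Prop,
       (forall t, A t -> T t) /\
       (forall t u, A t -> A u -> ~ psub t u) /\
       card_le K {t | A t}).

Definition cofinite (Z : nat -> Prop) : Prop := exists l : list nat, forall n, ~ Z n -> In n l.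

Definition ascent_path (T : node -> Prop) (f : K -> nat -> node) : Prop :=
  (forall a n, T (f a n) /\ height (f a n) = a) /\
  (forall a b, ltK a b -> cofinite (fun n => psub (f a n) (f b n))).

Definition injective_path (f : K -> nat -> node) : Prop :=
  exists a (I : nat -> Prop), cofinite I /\
    forall m n, I m -> I n -> f a m = f a n -> m = n.

End Kappa.

(* Main.v *)
(* The tree is built by recursion on the level; successor levels contain exactly what prolificness
   asks for. At a limit a, each node x at a level in C_a generates a branch through x that climbs
   along C_a; when it steps into level b it passes, if possible, through a node of the set guessed
   by Z_b. Level a consists of these branches together with countably many nodes f_a(n): f_a(n)
   copies f_b(n) along C_a as long as this is consistent and for at most n steps past the last
   accumulation point of C_a, and then climbs as above. Since the C_a cohere, a climb along C_a
   restricts at an accumulation point b of C_a to a climb along C_b, so it stays in the tree, and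
   f_a(n) extends f_b(n) for almost all n.

   Let D be a dense set of nodes. The levels at which D is guessed correctly form a cofinal set,
   hence there is a limit a such that this set contains succ_omega (C_a \ b) for cofinally many b
   in C_a. A climb meets D at each such step, and f_a(n) climbs after n of them, so every node of
   level a extends a node of D. With D the nodes that extend an element of a given antichain or have
   no extension in it, all elements of the antichain lie below level a; with D the complement of a
   branch, the branch does not reach level a.

   Sequences of length a are represented by functions on K that vanish outside a. *)
From Stdlib Require Import List Arith Lia FinFun Cantor.
From Stdlib Require Import Classical ClassicalEpsilon FunctionalExtensionality.
From Stdlib Require Import PropExtensionality ProofIrrelevance.
Require Import Defs.

Set Implicit Arguments.

(** * Classical decisions and recursion along a well-founded relation *)

Definition dec (P : Prop) : {P} + {~ P} := excluded_middle_informative P.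

Lemma sig_inj (A : Type) (P : A -> Prop) (x y : {a | P a}) : proj1_sig x = proj1_sig y -> x = y.
Proof.
  destruct x as [x hx], y as [y hy]; simpl; intros ->. f_equal; apply proof_irrelevance.
Qed.

Lemma card_le_trans (A B D : Type) : card_le A B -> card_le B D -> card_le A D.
Proof. intros [f Hf] [g Hg]; exists (fun x => g (f x)); auto. Qed.

Section WellFoundedRecursion.

Variables (A B : Type) (R : A -> A -> Prop) (b0 : B).
Hypothesis R_wf : well_founded R.
Variable F : A -> (A -> B) -> B.

(** [F] receives the recursive calls as a total function with default [b0] instead of handling
    proofs of [R b a]; the recursion equation then asks that [F] look only below its argument. *)
Definition wfrec : A -> B :=
  Fix R_wf (fun _ => B)
    (fun a rec => F a (fun b => match dec (R b a) with left h => rec b h | right _ => b0 end)).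

Lemma wfrec_eq :
  (forall a d d', (forall b, R b a -> d b = d' b) -> F a d = F a d') ->
  forall a, wfrec a = F a wfrec.
Proof.
  intros ext a. unfold wfrec at 1. rewrite Fix_eq.
  - apply ext. intros b ba. destruct (dec (R b a)); [reflexivity|contradiction].
  - intros x f g fg. f_equal. apply functional_extensionality. intros b.
    destruct (dec (R b x)); auto.
Qed.

End WellFoundedRecursion.

Section Tree.

Variable K : Type.
Variable ltK : K -> K -> Prop.
Hypothesis reg : regular_uncountable_cardinal ltK.

Local Notation "x << y" := (ltK x y) (at level 70).
Local Notation "x <<= y" := (leK ltK x y) (at level 70).

(** * Ordinals below kappa *)

Lemma lt_irrefl x : ~ x << x.
Proof. apply reg. Qed.

Lemma lt_trans x y z : x << y -> y << z -> x << z.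
Proof. apply reg. Qed.

Lemma lt_total x y : x << y \/ x = y \/ y << x.
Proof. apply reg. Qed.

Lemma lt_wf : well_founded ltK.
Proof. apply reg. Qed.

Lemma not_lt x y : ~ x << y -> y << x \/ y = x.
Proof. destruct (lt_total x y) as [|[|]]; intuition congruence. Qed.

Lemma lt_eq_l x y z : x = y -> y << z -> x << z.
Proof. congruence. Qed.

Lemma lt_eq_r x y z : x << y -> y = z -> x << z.
Proof. congruence. Qed.

(** Works by refutation: totality yields the alternatives to the goal, negations become weak
    inequalities, and the facts are saturated under transitivity and equality until some [x << x]
    appears. *)
Ltac ord :=
  unfold leK in *; try (match goal with |- ~ _ => intro end);
  match goal with
  | |- ?x << ?y => destruct (lt_total x y) as [?|[?|?]]; [assumption|exfalso|exfalso]
  | |- ?x << ?y \/ ?x = ?y =>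
      destruct (lt_total x y) as [?|[?|?]]; [left; assumption|right; assumption|exfalso]
  | |- @eq K ?x ?y => destruct (lt_total x y) as [?|[?|?]]; [exfalso|assumption|exfalso]
  | _ => exfalso
  end;
  repeat match goal with H : ~ (_ << _ \/ _ = _) |- _ => apply not_or_and in H as [? ?] end;
  repeat match goal with H : ~ _ << _ |- _ => apply not_lt in H end;
  repeat match goal with
  | H : _ << _ \/ _ = _ |- _ => destruct H
  | H : _ = _ \/ _ << _ |- _ => destruct H
  end;
  repeat match goal with
  | H1 : ?x << ?y, H2 : ?y << ?z |- _ =>
      lazymatch goal with
      | H : x << z |- _ => fail
      | _ => pose proof (lt_trans H1 H2)
      end
  | H1 : @eq K ?x ?y, H2 : ?x << ?z |- _ =>
      lazymatch goal with
      | H : y << z |- _ => fail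
      | _ => pose proof (lt_eq_l (eq_sym H1) H2)
      end
  | H1 : @eq K ?x ?y, H2 : ?z << ?x |- _ =>
      lazymatch goal with
      | H : z << y |- _ => fail
      | _ => pose proof (lt_eq_r H2 H1)
      end
  | H1 : @eq K ?y ?x, H2 : ?x << ?z |- _ =>
      lazymatch goal with
      | H : y << z |- _ => fail
      | _ => pose proof (lt_eq_l H1 H2)
      end
  | H1 : @eq K ?y ?x, H2 : ?z << ?x |- _ =>
      lazymatch goal with
      | H : z << y |- _ => fail
      | _ => pose proof (lt_eq_r H2 (eq_sym H1))
      end
  end;
  first [match goal with H : ?x << ?x |- _ => exact (lt_irrefl H) end | congruence].

Lemma K_inhabited : inhabited K.
Proof.
  apply NNPP; intro n. destruct reg as (_ & _ & _ & unc). apply unc.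
  exists (fun _ => 0). intros x; destruct n; constructor; exact x.
Qed.

Definition least (P : K -> Prop) : K := epsilon K_inhabited (fun x => P x /\ forall y, P y -> x <<= y).

Lemma least_spec (P : K -> Prop) :
  (exists x, P x) -> P (least P) /\ forall y, P y -> least P <<= y.
Proof.
  intros [x Px]. unfold least. apply epsilon_spec. revert Px.
  induction x as [x IH] using (well_founded_ind lt_wf). intros Px.
  destruct (classic (exists y, y << x /\ P y)) as [(y & yx & Py)|n]; [eauto|].
  exists x; split; auto. intros y Py.
  destruct (classic (y << x)); [destruct n; eauto|ord].
Qed.

Definition small (I : Type) : Prop := forall F : I -> K, exists b, forall i, F i << b.

(** Regularity speaks of subsets of [K], so it is applied to the range of [F]. If [K] embedded in
    the range, choosing preimages would embed [K] in [I]. *)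
Lemma small_of_not_ge (I : Type) : ~ card_le K I -> small I.
Proof.
  intros n F. destruct reg as (_ & _ & bd & _).
  destruct (bd (fun x => exists i, F i = x)) as [b Hb].
  - split; [exists (@proj1_sig _ _); intros; now apply sig_inj|].
    intros [phi Hphi]; apply n.
    destruct (choice (fun (x : K) i => F i = proj1_sig (phi x))) as [c Hc].
    { intros x. exact (proj2_sig (phi x)). }
    exists c. intros x y e. apply Hphi, sig_inj. now rewrite <- !Hc, e.
  - exists b; eauto.
Qed.

Lemma bounded_image a (F : K -> K) : exists b, forall j, j << a -> F j << b.
Proof.
  destruct reg as (_ & ini & _ & _).
  destruct (small_of_not_ge (ini a) (fun j => F (proj1_sig j))) as [b Hb].
  exists b; intros j ja. exact (Hb (exist _ j ja)).
Qed.

Lemma bounded_seq (F : nat -> K) : exists b, forall n, F n << b.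
Proof. destruct reg as (_ & _ & _ & unc). exact (small_of_not_ge unc F). Qed.

Lemma no_max a : exists b, a << b.
Proof. destruct (bounded_seq (fun _ => a)) as [b Hb]; exists b; exact (Hb 0). Qed.

Lemma upper2 a b : exists c, a << c /\ b << c.
Proof.
  destruct (bounded_seq (fun n => match n with 0 => a | _ => b end)) as [c Hc].
  exists c; split; [exact (Hc 0)|exact (Hc 1)].
Qed.

Definition zero : K := least (fun _ => True).

Lemma zero_le x : zero <<= x.
Proof.
  destruct (least_spec (fun _ => True)) as [_ H]; [|now apply H].
  destruct K_inhabited; eauto.
Qed.

Definition sc (a : K) : K := least (fun b => a << b).

Lemma lt_sc a : a << sc a.
Proof. exact (proj1 (least_spec _ (no_max a))). Qed.

Lemma sc_le a b : a << b -> sc a <<= b.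
Proof. exact (proj2 (least_spec _ (no_max a)) b). Qed.

Lemma lt_sc_le a b : a << sc b -> a <<= b.
Proof. intros H. destruct (lt_total b a) as [h|h]; [pose proof (sc_le h); ord|ord]. Qed.

Lemma ordinal_cases a : a = zero \/ (exists b, a = sc b) \/ is_limit ltK a.
Proof.
  destruct (classic (a = zero)) as [|n0]; [auto|right].
  destruct (classic (exists b, b << a /\ a <<= sc b)) as [(b & ba & ab)|n].
  - left; exists b. pose proof (sc_le ba). ord.
  - right; split; [exists zero; pose proof (zero_le a); ord|].
    intros b ba; exists (sc b); split; [apply lt_sc|].
    apply NNPP; intro h; apply n; exists b; split; [auto|ord].
Qed.

Lemma limit_sc a b : is_limit ltK a -> b << a -> sc b << a.
Proof. intros [_ H] ba. destruct (H b ba) as (g & bg & ga). pose proof (sc_le bg). ord. Qed.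

Lemma limit_not_sc a b : is_limit ltK a -> a <> sc b.
Proof. intros H ->. exact (lt_irrefl (limit_sc H (lt_sc b))). Qed.

Lemma limit_not_zero a : is_limit ltK a -> a <> zero.
Proof. intros [[b ba] _] ->. pose proof (zero_le b); ord. Qed.

Lemma sc_not_zero b : sc b <> zero.
Proof. intros e. pose proof (lt_sc b); rewrite e in *. pose proof (zero_le b); ord. Qed.

Lemma sc_inj a b : sc a = sc b -> a = b.
Proof.
  intros e. pose proof (lt_sc a) as h1; pose proof (lt_sc b) as h2.
  rewrite e in h1; rewrite <- e in h2. apply lt_sc_le in h1, h2. ord.
Qed.

Fixpoint fin (n : nat) : K := match n with 0 => zero | S n => sc (fin n) end.

Definition omega : K := least (fun x => forall n, fin n << x).

Lemma fin_lt_omega n : fin n << omega.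
Proof. exact (proj1 (least_spec _ (bounded_seq fin)) n). Qed.

Lemma fin_mono m n : m < n -> fin m << fin n.
Proof.
  induction 1; simpl; [apply lt_sc|]. pose proof (lt_sc (fin m0)). ord.
Qed.

Lemma fin_inj m n : fin m = fin n -> m = n.
Proof.
  intros e. destruct (Nat.lt_trichotomy m n) as [h|[h|h]]; auto;
    apply fin_mono in h; rewrite e in h; destruct (lt_irrefl h).
Qed.

Lemma lt_fin n x : x << fin n -> exists m, m < n /\ x = fin m.
Proof.
  induction n; simpl; intros h; [pose proof (zero_le x); ord|].
  apply lt_sc_le in h as [h| ->]; [|eauto].
  destruct (IHn h) as (m & ? & ?); eauto.
Qed.

Lemma lt_omega_fin x : x << omega -> exists n, x = fin n.
Proof.
  intros h. destruct (classic (forall n, fin n << x)) as [H|H].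
  - pose proof (proj2 (least_spec _ (bounded_seq fin)) x H : omega <<= x). ord.
  - apply not_all_ex_not in H as [n H]. apply not_lt in H as [H|H]; [|eauto].
    destruct (lt_fin _ H) as (m & _ & ?); eauto.
Qed.

Lemma lt_omega_iff x : lt_omega ltK x <-> x << omega.
Proof.
  split.
  - intros [l Hl]. apply NNPP; intros n.
    (* If [x] is at least [omega], the list [l] holds every [fin k], and one more of them than its
       length is too many. *)
    assert (incl (map fin (seq 0 (S (length l)))) l) as I.
    { intros y hy. apply in_map_iff in hy as (k & <- & _). apply Hl.
      pose proof (fin_lt_omega k). ord. }
    apply NoDup_incl_length in I; [rewrite length_map, length_seq in I; lia|].
    apply Injective_map_NoDup; [exact fin_inj|apply seq_NoDup].
  - intros h. destruct (lt_omega_fin h) as [n ->]. exists (map fin (seq 0 n)).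
    intros j hj. destruct (lt_fin _ hj) as (m & hm & ->). apply in_map, in_seq. lia.
Qed.

(** Bounds both the values that prolificness asks for above level [a] and, by [lvl_covered], the
    size of level [a]. *)
Definition max_omega (a : K) : K := if dec (omega << a) then a else omega.

Lemma omega_le_max a : omega <<= max_omega a.
Proof. unfold max_omega; destruct dec; ord. Qed.

Lemma le_max_omega a : a <<= max_omega a.
Proof. unfold max_omega; destruct dec; ord. Qed.

Lemma max_omega_mono a b : a <<= b -> max_omega a <<= max_omega b.
Proof. unfold max_omega; do 2 destruct dec; intros; ord. Qed.

Lemma lt_max_omega i a : i << max_omega a <-> i << omega \/ i << a.
Proof.
  pose proof (omega_le_max a); pose proof (le_max_omega a).
  split; [|intros [|]; ord]. unfold max_omega; destruct dec; auto.
Qed.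

Definition E_closed (F : K -> K) (a : K) : Prop := pos ltK a /\ forall x, x << a -> F x << a.

(** For unboundedness, [N] is iterated omega times; the supremum exists in [K] because countable
    sequences are bounded, and it is closed under [F]. *)
Lemma club_closed_points (F : K -> K) : club ltK (E_closed F).
Proof.
  split.
  - intros b.
    assert (exists N : K -> K, forall c, c << N c /\ forall x, x <<= c -> F x << N c) as [N HN].
    { apply (choice (fun c d => c << d /\ forall x, x <<= c -> F x << d)). intros c.
      destruct (bounded_image (sc c) F) as [d Hd]. destruct (upper2 c d) as (e & ce & de).
      exists e; split; auto. intros x xc.
      assert (x << sc c) as h by (pose proof (lt_sc c); ord). pose proof (Hd x h). ord. }
    set (c := fix c n := match n with 0 => N b | S n => N (c n) end).
    destruct (least_spec _ (bounded_seq c)) as [H1 H2].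
    set (g := least _) in *. exists g; split.
    + split; [exists (c 0); apply H1|]. intros x xg.
      assert (exists n, x <<= c n) as [n Hn].
      { apply NNPP; intros no. assert (g <<= x); [|ord]. apply H2. intros n.
        apply NNPP; intro; apply no; exists n; ord. }
      pose proof (proj2 (HN (c n)) x Hn). pose proof (H1 (S n)). simpl in *. ord.
    + pose proof (proj1 (HN b)). pose proof (H1 0). simpl in *. ord.
  - intros g pg [_ H]. split; auto. intros x xg.
    destruct (H x xg) as (e & [[_ He] eg] & xe). pose proof (He x xe). ord.
Qed.

(** * Pairing *)

Definition pmax (p : K * K) : K := if dec (fst p << snd p) then snd p else fst p.

(** Goedel's well-order of pairs: by maximum, then lexicographically. Pairs before [p] have both
    coordinates at most [pmax p]. *)
Definition glt (q p : K * K) : Prop :=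
  pmax q << pmax p \/
  (pmax q = pmax p /\ (fst q << fst p \/ (fst q = fst p /\ snd q << snd p))).

Lemma glt_wf : well_founded glt.
Proof.
  enough (forall m x y, pmax (x, y) = m -> Acc glt (x, y)) as H by (intros [x y]; eauto).
  intros m; induction m as [m IHm] using (well_founded_ind lt_wf).
  intros x; induction x as [x IHx] using (well_founded_ind lt_wf).
  intros y; induction y as [y IHy] using (well_founded_ind lt_wf).
  intros e. constructor. intros [x' y'] [h|[h [h'|[h' h'']]]]; rewrite e in h; simpl in *; subst; eauto.
Qed.

Lemma glt_total p q : glt p q \/ p = q \/ glt q p.
Proof.
  unfold glt. destruct p as [x y], q as [x' y']. simpl.
  destruct (lt_total (pmax (x, y)) (pmax (x', y'))) as [h|[h|h]]; auto. rewrite h.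
  destruct (lt_total x x') as [h'|[->|h']]; try tauto.
  destruct (lt_total y y') as [h''|[->|h'']]; tauto.
Qed.

Lemma le_pmax p : fst p <<= pmax p /\ snd p <<= pmax p.
Proof. unfold pmax; destruct dec; split; ord. Qed.

Lemma pmax_lt p a : fst p << a -> snd p << a -> pmax p << a.
Proof. unfold pmax; destruct dec; auto. Qed.

Lemma glt_le p q : glt q p -> fst q <<= pmax p /\ snd q <<= pmax p.
Proof.
  intros h. destruct (le_pmax q). assert (pmax q <<= pmax p) by (destruct h as [|[]]; ord). split; ord.
Qed.

(* Each pair is sent to the least value not yet taken by its predecessors. *)
Definition godel : K * K -> K :=
  wfrec zero glt_wf (fun p g => least (fun x => forall q, glt q p -> g q <> x)).

Lemma godel_eq p : godel p = least (fun x => forall q, glt q p -> godel q <> x).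
Proof.
  unfold godel at 1. rewrite wfrec_eq; [reflexivity|].
  intros a d d' h. f_equal. apply functional_extensionality; intros x.
  apply propositional_extensionality; split; intros H q qa; [rewrite <- h|rewrite h]; auto.
Qed.

Lemma godel_fresh p x : (forall q, glt q p -> godel q <> x) ->
  godel p <<= x /\ forall q, glt q p -> godel q <> godel p.
Proof.
  intros hx. rewrite (godel_eq p).
  destruct (least_spec (fun x => forall q, glt q p -> godel q <> x)) as [h1 h2]; eauto.
Qed.

Lemma omega_sc x : x << omega -> sc x << omega.
Proof. intros h. destruct (lt_omega_fin h) as [n ->]. exact (fin_lt_omega (S n)). Qed.

(** Hilbert's hotel: for infinite [m], the top point goes to zero and the finite ordinals move up by
    one. *)
Lemma squeeze_max m : exists e : K -> K,
  (forall x, x <<= m -> e x << max_omega m) /\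
  (forall x y, x <<= m -> y <<= m -> e x = e y -> x = y).
Proof.
  destruct (classic (m << omega)) as [h|h].
  { exists (fun x => x). split; auto. intros x xm. apply lt_max_omega. left; ord. }
  exists (fun x => if dec (x = m) then zero else if dec (x << omega) then sc x else x).
  assert (omega <<= m) as h' by ord. clear h. split.
  - intros x xm. apply lt_max_omega. destruct dec; [left; exact (fin_lt_omega 0)|].
    destruct dec as [l|l]; [left; now apply omega_sc|right; ord].
  - intros x y xm ym. pose proof (fin_lt_omega 0) as h0; simpl in h0.
    pose proof (sc_not_zero x). pose proof (sc_not_zero y).
    pose proof (@omega_sc x) as hx; pose proof (@omega_sc y) as hy.
    destruct (dec (x = m)), (dec (y = m)), (dec (x << omega)), (dec (y << omega)); intros E;
      try congruence; try (now apply sc_inj);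
      try (specialize (hx ltac:(assumption))); try (specialize (hy ltac:(assumption))); ord.
Qed.

Definition squared (a : K) : Prop := exists h : K -> K -> K,
  (forall x y, x << a -> y << a -> h x y << a) /\
  (forall x y x' y', x << a -> y << a -> x' << a -> y' << a -> h x y = h x' y' -> x = x' /\ y = y').

(* Below an ordinal that embeds into no smaller infinite one, [godel] is a pairing; other ordinals
   inherit their pairing. *)
Lemma squared_infinite a : omega <<= a -> squared a.
Proof.
  induction a as [a IH] using (well_founded_ind lt_wf). intros wa.
  destruct (classic (exists b e, b << a /\ omega <<= b /\ (forall x, x << a -> e x << b) /\
     forall x y, x << a -> y << a -> e x = e y -> x = y)) as [(b & e & ba & wb & eb & ei)|ini].
  { destruct (IH b ba wb) as (h & hb & hi). exists (fun x y => h (e x) (e y)). split.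
    - intros x y xa ya. pose proof (hb _ _ (eb x xa) (eb y ya)). ord.
    - intros x y x' y' xa ya xa' ya' E. apply hi in E as [E1 E2]; auto. }
  (* Omega gets Cantor's pairing, since only above it does [pmax p << a] force
     [max_omega (pmax p) << a]. *)
  destruct (classic (a = omega)) as [->|na].
  { assert (exists idx : K -> nat, forall x, x << omega -> x = fin (idx x)) as [idx Hidx].
    { apply (choice (fun x n => x << omega -> x = fin n)). intros x.
      destruct (classic (x << omega)) as [l|l]; [|exists 0; tauto].
      destruct (lt_omega_fin l) as [n ?]; eauto. }
    exists (fun x y => fin (Cantor.to_nat (idx x, idx y))). split; [intros; apply fin_lt_omega|].
    intros x y x' y' hx hy hx' hy' E. apply fin_inj, (f_equal Cantor.of_nat) in E.
    rewrite !Cantor.cancel_of_to in E. injection E as E1 E2.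
    rewrite (Hidx x), (Hidx y), (Hidx x'), (Hidx y'), E1, E2; auto. }
  (* If every value below [a] were taken before [p], then sending a value to a pair that takes it,
     squeezing the coordinates and pairing them would embed [a] in the smaller infinite ordinal
     [max_omega (pmax p)]. *)
  assert (forall p, fst p << a -> snd p << a ->
    exists x, x << a /\ forall q, glt q p -> godel q <> x) as fresh.
  { intros p p1 p2. apply NNPP; intros no.
    assert (exists Q : K -> K * K, forall x, x << a -> glt (Q x) p /\ godel (Q x) = x) as [Q HQ].
    { apply (choice (fun x q => x << a -> glt q p /\ godel q = x)). intros x.
      apply NNPP; intros n. apply no. exists x; split.
      - apply NNPP; intros ?. apply n; exists p; tauto.
      - intros q qp E. apply n; eauto. }
    destruct (squeeze_max (pmax p)) as (e & eb & ei).
    pose proof (pmax_lt _ p1 p2) as pa.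
    assert (max_omega (pmax p) << a) as ma by (unfold max_omega; destruct dec; ord).
    destruct (IH _ ma (omega_le_max _)) as (h & hb & hi).
    apply ini. exists (max_omega (pmax p)), (fun x => h (e (fst (Q x))) (e (snd (Q x)))).
    split; [|split; [apply omega_le_max|split]]; auto.
    - intros x xa. destruct (HQ x xa) as [q _]. apply glt_le in q. apply hb; apply eb; tauto.
    - intros x y xa ya E. destruct (HQ x xa) as [q1 <-], (HQ y ya) as [q2 <-].
      apply glt_le in q1 as [], q2 as []. apply hi in E as [E1 E2]; auto.
      apply ei in E1, E2; auto.
      destruct (Q x), (Q y); simpl in *; congruence. }
  exists (fun x y => godel (x, y)). split.
  - intros x y xa ya. destruct (fresh (x, y) xa ya) as (z & za & hz).
    apply godel_fresh in hz as [hz _]. ord.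
  - intros x y x' y' xa ya xa' ya' E.
    destruct (fresh (x, y) xa ya) as (z & _ & hz). apply godel_fresh in hz as [_ hz].
    destruct (fresh (x', y') xa' ya') as (z' & _ & hz'). apply godel_fresh in hz' as [_ hz'].
    destruct (glt_total (x, y) (x', y')) as [l|[l|l]]; [|split; congruence|].
    + destruct (hz' _ l E).
    + destruct (hz _ l (eq_sym E)).
Qed.

Lemma bounded_image2 a (F : K -> K -> K) : exists b, forall x y, x << a -> y << a -> F x y << b.
Proof.
  destruct (choice _ (fun x => bounded_image a (F x))) as [G HG].
  destruct (bounded_image a G) as [b Hb]. exists b. intros x y xa ya.
  pose proof (HG x y ya); pose proof (Hb x xa). ord.
Qed.

Lemma godel_inj p q : godel p = godel q -> p = q.
Proof.
  assert (forall p, exists x, forall q, glt q p -> godel q <> x) as fresh.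
  { intros r. destruct (bounded_image2 (sc (pmax r)) (fun x y => godel (x, y))) as [b Hb].
    exists b. intros [x y] l E. apply glt_le in l as [l1 l2]. simpl in *.
    pose proof (lt_sc (pmax r)). assert (godel (x, y) << b) by (apply Hb; ord). ord. }
  intros E. destruct (fresh p) as [x hx], (fresh q) as [y hy].
  apply godel_fresh in hx as [_ hx], hy as [_ hy].
  destruct (glt_total p q) as [l|[l|l]]; auto; [destruct (hy _ l E)|destruct (hx _ l (eq_sym E))].
Qed.

(** * Bounding sizes by enumerations, which pass directly to images and unions *)

Definition covered {X : Type} (a : K) (P : X -> Prop) : Prop :=
  exists e : K -> X, forall x, P x -> exists j, j << a /\ e j = x.

Lemma covered_pairs a : omega <<= a -> covered a (fun p => fst p << a /\ snd p << a).
Proof.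
  intros wa. destruct (squared_infinite wa) as (h & hb & hi).
  exists (fun j => epsilon (inhabits (zero, zero))
    (fun p => (fst p << a /\ snd p << a) /\ h (fst p) (snd p) = j)).
  intros p [p1 p2]. exists (h (fst p) (snd p)). split; auto.
  match goal with |- epsilon ?i ?P = _ => destruct (epsilon_spec i P) as [[q1 q2] E]; eauto end.
  apply hi in E as [E1 E2]; auto.
  match goal with |- ?q = _ => destruct q, p; simpl in *; congruence end.
Qed.

Lemma covered_mono {X : Type} a b (P Q : X -> Prop) :
  a <<= b -> (forall x, Q x -> P x) -> covered a P -> covered b Q.
Proof.
  intros ab PQ [e He]. exists e. intros x Qx. destruct (He x (PQ x Qx)) as (j & ja & E).
  exists j; split; [ord|auto].
Qed.

Lemma covered_image {X Y : Type} a (P : X -> Prop) (F : X -> Y) :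
  covered a P -> covered a (fun y => exists x, P x /\ F x = y).
Proof.
  intros [e He]. exists (fun j => F (e j)). intros y (x & Px & <-).
  destruct (He x Px) as (j & ja & <-); eauto.
Qed.

(** An enumeration is chosen for every [P i], and each index is decoded into a pair, since [a] times
    [a] is no larger than [a]. *)
Lemma covered_union {X : Type} (x0 : X) a (P : K -> X -> Prop) : omega <<= a ->
  (forall i, i << a -> covered a (P i)) -> covered a (fun p => fst p << a /\ P (fst p) (snd p)).
Proof.
  intros wa H. destruct (covered_pairs wa) as [c Hc].
  assert (exists E : K -> K -> X, forall i, i << a -> forall x, P i x -> exists j, j << a /\ E i j = x)
    as [E HE].
  { apply (choice (fun i (e : K -> X) => i << a -> forall x, P i x -> exists j, j << a /\ e j = x)).
    intros i. destruct (classic (i << a)) as [l|l]; [|exists (fun _ => x0); tauto].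
    destruct (H i l) as [e He]; eauto. }
  exists (fun j => (fst (c j), E (fst (c j)) (snd (c j)))).
  intros [i x] [ia Px]. simpl in *. destruct (HE i ia x Px) as (k & ka & <-).
  destruct (Hc (i, k)) as (j & ja & e); auto. exists j. rewrite e. auto.
Qed.

Lemma covered_bounded {X : Type} a (P : X -> Prop) (F : X -> K) :
  covered a P -> exists b, forall x, P x -> F x << b.
Proof.
  intros [e He]. destruct (bounded_image a (fun j => F (e j))) as [b Hb]. exists b.
  intros x Px. destruct (He x Px) as (j & ja & <-). auto.
Qed.

Lemma not_covered a : ~ covered a (fun _ : K => True).
Proof.
  intros H. destruct (covered_bounded (fun x => x) H) as [b Hb]. exact (lt_irrefl (Hb b I)).
Qed.

(** * Runs along the C-sequence *)

(** The default zero lets initial segments be compared by plain equality of functions on [K]. *)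
Definition res (a : K) (g : K -> K) : K -> K := fun x => if dec (x << a) then g x else zero.

Lemma res_at a g x : x << a -> res a g x = g x.
Proof. unfold res; destruct dec; tauto. Qed.

Lemma res_ext a g h : (forall x, x << a -> g x = h x) -> res a g = res a h.
Proof. intros H. apply functional_extensionality; intros x. unfold res; destruct dec; auto. Qed.

Lemma res_res a b g : b <<= a -> res b (res a g) = res b g.
Proof. intros ba. apply res_ext. intros x xb. apply res_at. ord. Qed.

Lemma res_trans a b g h : b <<= a -> res a g = h -> res b g = res b h.
Proof. intros ba <-. now rewrite res_res. Qed.

Variable C : K -> K -> Prop.
Variable Z : K -> K -> Prop.
Hypothesis C_club : forall a, is_limit ltK a -> club_in ltK (C a) a.
Hypothesis C_coherent : forall a b, acc ltK (C a) b -> sqsub ltK (C b) (C a).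

Definition pred_in (D : K -> Prop) (b p : K) : Prop :=
  D p /\ p << b /\ forall c, D c -> c << b -> c <<= p.

Definition first_in (D : K -> Prop) (b : K) : Prop := forall c, D c -> ~ c << b.

Lemma acc_limit D b : acc ltK D b -> is_limit ltK b.
Proof.
  intros (_ & pb & _ & H). split; auto. intros x xb. destruct (H x xb) as (y & [_ yb] & xy); eauto.
Qed.

Lemma acc_not_pred D b p : acc ltK D b -> ~ pred_in D b p.
Proof.
  intros (_ & _ & _ & H) (Dp & pb & mp). destruct (H p pb) as (x & [Dx xb] & px).
  pose proof (mp x Dx xb). ord.
Qed.

(** If [D] has elements below [b], their supremum is either [b] itself or, by closure, a member of
    [D] and hence the predecessor of [b]. *)
Lemma club_in_cases D a b : club_in ltK D a -> D b ->
  (exists p, pred_in D b p) \/ acc ltK D b \/ first_in D b.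
Proof.
  intros (Da & _ & clo) Db.
  destruct (classic (exists c, D c /\ c << b)) as [(c & Dc & cb)|n].
  2: { right; right; intros c Dc cb; apply n; eauto. }
  destruct (classic (exists p, pred_in D b p)) as [|np]; [auto|right; left].
  set (U := fun x => forall c, D c -> c << b -> c <<= x).
  destruct (least_spec U) as [h1 h2]; [exists b; intros ? ? ?; ord|].
  assert (U b) as Ub by (intros ? ? ?; ord).
  assert (forall g, g << least U -> exists x, inter_below ltK D b x /\ g << x) as cof.
  { intros g gs. apply NNPP; intros no. assert (U g) as Ug; [|pose proof (h2 g Ug); ord].
    intros x Dx xb. apply NNPP; intros ?. apply no; exists x; split; [split; auto|ord]. }
  set (s := least U) in *.
  assert (s = b) as Esb.
  { apply NNPP; intros sb. pose proof (h2 b Ub). apply np. exists s. split; [|split; auto; ord].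
    apply NNPP; intros nDs. apply nDs. assert (b << a) by auto.
    assert (forall x, D x -> x << b -> x << s) as lt.
    { intros x Dx xb. destruct (h1 x Dx xb) as [|e]; auto. destruct nDs; congruence. }
    apply clo; [ord|exists c; auto|].
    split; [intros x []; left; auto|]. intros g gs. destruct (cof g gs) as (x & [Dx xb] & gx).
    exists x; repeat split; auto. }
  rewrite Esb in cof. split; [auto|split; [exists c; auto|split; auto]].
  intros x [_ ?]; left; auto.
Qed.

(** Coherence gives only some bound [e] for the initial segment; it is at least [b] because [C b] is
    cofinal in [b]. *)
Lemma acc_agree a b x : acc ltK (C a) b -> x << b -> (C b x <-> C a x).
Proof.
  intros H xb. destruct (C_coherent H) as [e He]. rewrite He.
  destruct (C_club (acc_limit H)) as (_ & [_ cof] & _).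
  assert (b <<= e).
  { apply NNPP; intros ?. assert (e << b) as eb by ord.
    destruct (cof e eb) as (y & Cy & ey). apply He in Cy as []. ord. }
  split; [tauto|split; [auto|ord]].
Qed.

Lemma club_in_cofinal a x : is_limit ltK a -> x << a -> exists c, C a c /\ c << a /\ x << c.
Proof.
  intros la xa. destruct (C_club la) as (h & [_ cof] & _). destruct (cof x xa) as (c & ? & ?); eauto.
Qed.

(* By diamond every bounded subset of [K] is some [Z d], so every sequence has a code [d] which does
   not depend on the tree under construction. *)
Definition codes (d a : K) (g : K -> K) : Prop :=
  forall x, Z d x <-> exists y, y << a /\ godel (y, g y) = x.

(** [Z b] is read as a set of codes: some initial segment of [g] of length below [b] is among the
    sequences guessed at [b]. *)
Definition hits (b : K) (g : K -> K) : Prop := exists d a, Z b d /\ a << b /\ codes d a g.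

(** The choice depends on [Lb], [b], [p] and [g] but not on the limit aimed at, so climbs along
    cohering clubs choose alike. *)
Definition step (Lb : (K -> K) -> Prop) (b p : K) (g : K -> K) : K -> K :=
  epsilon (inhabits (fun x => x)) (fun y => Lb y /\ res p y = g /\
    ((exists y', Lb y' /\ res p y' = g /\ hits b y') -> hits b y)).

Lemma step_spec (Lb : (K -> K) -> Prop) b p g : (exists y, Lb y /\ res p y = g) ->
  Lb (step Lb b p g) /\ res p (step Lb b p g) = g /\
  ((exists y', Lb y' /\ res p y' = g /\ hits b y') -> hits b (step Lb b p g)).
Proof.
  intros (y & Ly & E). unfold step. apply epsilon_spec.
  destruct (classic (exists y', Lb y' /\ res p y' = g /\ hits b y')) as [(y' & ? & ? & ?)|n]; eauto.
  exists y; tauto.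
Qed.

(** The union of the chain of nodes [r c]: the value at [x] is read off the first of them that is
    longer than [x]. *)
Definition glue (D : K -> Prop) (r : K -> K -> K) (b : K) : K -> K := fun x =>
  if dec (exists c, D c /\ c << b /\ x << c) then r (least (fun c => D c /\ c << b /\ x << c)) x
  else zero.

Lemma glue_ext D D' r r' b : (forall c, c << b -> D c <-> D' c) ->
  (forall c, D c -> c << b -> r c = r' c) -> glue D r b = glue D' r' b.
Proof.
  intros HD Hr. apply functional_extensionality; intros x. unfold glue.
  replace (fun c => D' c /\ c << b /\ x << c) with (fun c => D c /\ c << b /\ x << c).
  2: { apply functional_extensionality; intros c. apply propositional_extensionality.
       pose proof (HD c). tauto. }
  replace (exists c, D' c /\ c << b /\ x << c) with (exists c, D c /\ c << b /\ x << c).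
  2: { apply propositional_extensionality; split; intros (c & ? & ? & ?); exists c; firstorder. }
  destruct dec as [e|]; auto. destruct (least_spec _ e) as [(? & ? & _) _]. now rewrite Hr.
Qed.

Lemma glue_res D r b : res b (glue D r b) = glue D r b.
Proof.
  apply functional_extensionality; intros x. unfold res, glue.
  destruct (dec (x << b)) as [|n]; auto. destruct dec as [(c & _ & ? & ?)|]; auto. destruct n; ord.
Qed.

Lemma glue_spec D r b :
  (forall c, D c -> c << b -> res c (r c) = r c) ->
  (forall c c', D c -> c << b -> D c' -> c' << c -> res c' (r c) = r c') ->
  forall c, D c -> c << b -> (forall x, x << b -> exists c', D c' /\ c' << b /\ x << c') ->
  res c (glue D r b) = r c.
Proof.
  intros can coh c Dc cb cof. rewrite <- (can c Dc cb). apply res_ext; intros x xc. unfold glue.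
  destruct dec as [e|n]; [|destruct n; exists c; auto].
  destruct (least_spec _ e) as [(Dc' & cb' & xc') _]. set (c' := least _) in *. clearbody c'.
  destruct (lt_total c c') as [l|[<-|l]]; auto.
  - rewrite <- (coh c' c); auto. now rewrite res_at.
  - rewrite <- (coh c c'); auto. now rewrite res_at.
Qed.

(* A run along [D] builds an increasing chain of nodes at the levels in [D]. The counter is the number
   of elements passed since the last accumulation point; it tells whether the chain still tries to
   copy [tgt]. *)
Definition run_step (L : K -> (K -> K) -> Prop) (D : K -> Prop) (tgt : K -> K -> K)
    (cond : K -> nat -> Prop) (b : K) (r : K -> (K -> K) * nat) : (K -> K) * nat :=
  if dec (exists p, pred_in D b p) then
    let p := least (pred_in D b) in
    (if dec (cond b (snd (r p)) /\ res p (tgt b) = fst (r p)) then tgt b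
     else step (L b) b p (fst (r p)), S (snd (r p)))
  else if dec (exists c, D c /\ c << b) then (glue D (fun c => fst (r c)) b, 0)
  else (tgt b, 0).

Definition run L D tgt cond : K -> (K -> K) * nat :=
  wfrec (fun x => x, 0) lt_wf (run_step L D tgt cond).

(** Locality serves both the recursion equation and the comparison of runs along two cohering
    clubs. *)
Lemma run_step_ext L L' D D' tgt tgt' cond b r r' :
  L b = L' b -> (forall c, c << b -> D c <-> D' c) -> tgt b = tgt' b ->
  (forall c, c << b -> r c = r' c) -> run_step L D tgt cond b r = run_step L' D' tgt' cond b r'.
Proof.
  intros HL HD Ht Hr. unfold run_step.
  replace (pred_in D' b) with (pred_in D b).
  2: { apply functional_extensionality; intros p. apply propositional_extensionality.
       unfold pred_in; split; intros (h1 & h2 & h3); repeat split; auto; try (now apply HD);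
         intros c hc hb; apply h3; auto; now apply HD. }
  destruct dec as [e|].
  - destruct (least_spec _ e) as [(_ & l & _) _]. now rewrite Hr, HL, Ht.
  - replace (exists c, D' c /\ c << b) with (exists c, D c /\ c << b).
    2: { apply propositional_extensionality; split; intros (c & ? & ?); exists c; firstorder. }
    destruct dec; [|congruence]. f_equal. apply glue_ext; auto.
    intros c _ cb. now rewrite Hr.
Qed.

Lemma run_eq L D tgt cond b : run L D tgt cond b = run_step L D tgt cond b (run L D tgt cond).
Proof. unfold run. apply wfrec_eq. intros; apply run_step_ext; tauto. Qed.

Lemma run_ext L L' D D' tgt tgt' cond a :
  (forall b, b << a -> L b = L' b) -> (forall b, b << a -> D b <-> D' b) ->
  (forall b, b << a -> tgt b = tgt' b) ->
  forall b, b << a -> run L D tgt cond b = run L' D' tgt' cond b.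
Proof.
  intros HL HD Ht b. induction b as [b IH] using (well_founded_ind lt_wf). intros ba.
  rewrite !run_eq. apply run_step_ext; auto; intros c cb; [apply HD|apply IH]; auto; ord.
Qed.

Lemma run_pred L D tgt cond b p : pred_in D b p ->
  run L D tgt cond b =
  (if dec (cond b (snd (run L D tgt cond p)) /\ res p (tgt b) = fst (run L D tgt cond p)) then tgt b
   else step (L b) b p (fst (run L D tgt cond p)), S (snd (run L D tgt cond p))).
Proof.
  intros H. rewrite run_eq. unfold run_step. destruct dec as [e|n]; [|destruct n; eauto].
  assert (least (pred_in D b) = p) as ->; auto.
  destruct (least_spec _ e) as [(h1 & h2 & h3) _]. destruct H as (h4 & h5 & h6).
  pose proof (h3 p h4 h5); pose proof (h6 _ h1 h2). ord.
Qed.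

Lemma run_acc L D tgt cond b : acc ltK D b ->
  run L D tgt cond b = (glue D (fun c => fst (run L D tgt cond c)) b, 0).
Proof.
  intros H. rewrite run_eq. unfold run_step.
  destruct dec as [[p e]|_]; [destruct (acc_not_pred H e)|].
  destruct dec as [|n]; auto. destruct n. destruct H as (_ & [x xb] & _ & cof).
  destruct (cof x xb) as (c & [] & _); eauto.
Qed.

Lemma run_first L D tgt cond b : first_in D b -> run L D tgt cond b = (tgt b, 0).
Proof.
  intros H. rewrite run_eq. unfold run_step.
  destruct dec as [(p & ? & ? & _)|_]; [destruct (H p); auto|].
  destruct dec as [(p & ? & ?)|_]; [destruct (H p); auto|auto].
Qed.

Definition branch L tgt cond a := glue (C a) (fun c => fst (run L (C a) tgt cond c)) a.

(** For [b] in [C a] and a node [x] of level [b], copying succeeds all the way up to [b], so the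
    branch passes through [x]. *)
Definition node_branch L a b x := branch L (fun c => res c x) (fun c _ => c <<= b) a.

Definition path_branch L (f : K -> nat -> K -> K) a n := branch L (fun c => f c n) (fun _ m => m < n) a.

(** * The tree and its path *)

Definition app (b : K) (g : K -> K) (i : K) : K -> K := fun x => if dec (x = b) then i else g x.

(** Level and path are built together, since a limit level contains path nodes that follow the
    earlier path. Appending [fin n] at successors separates the paths from level one on. The clause
    [b << a] keeps the step local. *)
Definition tree_step (a : K) (d : K -> ((K -> K) -> Prop) * (nat -> K -> K)) :
    ((K -> K) -> Prop) * (nat -> K -> K) :=
  let L c := fst (d c) in let f c := snd (d c) in
  if dec (a = zero) then (fun g => g = fun _ => zero, fun _ _ => zero)
  else if dec (exists b, a = sc b) then
    let b := least (fun b => a = sc b) in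
    (fun g => exists h i, L b h /\ i << max_omega b /\ g = app b h i, fun n => app b (f b n) (fin n))
  else
    (fun g => (exists n, g = path_branch L f a n) \/
       exists b x, (b << a /\ C a b /\ L b x) /\ node_branch L a b x = g,
     path_branch L f a).

Definition tree := wfrec (fun _ => True, fun _ x => x) lt_wf tree_step.

Definition lvl (a : K) : (K -> K) -> Prop := fst (tree a).
Definition pth (a : K) : nat -> K -> K := snd (tree a).

Lemma branch_ext L L' tgt tgt' cond a :
  (forall b, b << a -> L b = L' b) -> (forall b, b << a -> tgt b = tgt' b) ->
  branch L tgt cond a = branch L' tgt' cond a.
Proof.
  intros HL Ht. apply glue_ext; [tauto|]. intros c _ ca. f_equal.
  apply run_ext with a; auto; tauto.
Qed.

Lemma tree_eq a : tree a = tree_step a tree.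
Proof.
  unfold tree. apply wfrec_eq. clear a. intros a d d' H. unfold tree_step.
  destruct dec; auto. destruct dec as [e|].
  - destruct (least_spec _ e) as [h _]. rewrite H; auto. exact (lt_eq_r (lt_sc _) (eq_sym h)).
  - assert (path_branch (fun c => fst (d c)) (fun c => snd (d c)) a
      = path_branch (fun c => fst (d' c)) (fun c => snd (d' c)) a) as ->.
    { apply functional_extensionality; intros m. apply branch_ext; intros; now rewrite H. }
    f_equal. apply functional_extensionality; intros g. f_equal.
    apply propositional_extensionality; split; intros (b & x & (ba & Cb & Lx) & <-); exists b, x;
      (split; [rewrite H in * by auto; auto|]);
      apply branch_ext; intros; auto; now rewrite H.
Qed.

Lemma lvl_zero : lvl zero = fun g => g = fun _ => zero.
Proof. unfold lvl. rewrite tree_eq. unfold tree_step. destruct dec; [auto|congruence]. Qed.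

Lemma pth_zero n : pth zero n = fun _ => zero.
Proof. unfold pth. rewrite tree_eq. unfold tree_step. destruct dec; [auto|congruence]. Qed.

Lemma tree_sc b : tree (sc b) =
  (fun g => exists h i, lvl b h /\ i << max_omega b /\ g = app b h i, fun n => app b (pth b n) (fin n)).
Proof.
  rewrite tree_eq. unfold tree_step. destruct dec as [e|_]; [destruct (sc_not_zero b e)|].
  destruct dec as [e|n]; [|destruct n; eauto].
  assert (least (fun c => sc b = sc c) = b) as ->; auto.
  symmetry. apply sc_inj. exact (proj1 (least_spec _ e)).
Qed.

Lemma tree_limit a : is_limit ltK a -> tree a =
  (fun g => (exists n, g = path_branch lvl pth a n) \/
     exists b x, (b << a /\ C a b /\ lvl b x) /\ node_branch lvl a b x = g,
   path_branch lvl pth a).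
Proof.
  intros H. rewrite tree_eq. unfold tree_step.
  destruct dec as [e|_]; [destruct (limit_not_zero H e)|].
  destruct dec as [[b e]|n]; [destruct (limit_not_sc _ H e)|auto].
Qed.

Lemma pth_limit a n : is_limit ltK a -> pth a n = path_branch lvl pth a n.
Proof. intros H. unfold pth at 1. now rewrite (tree_limit H). Qed.

Lemma lvl_limit a g : is_limit ltK a -> lvl a g <->
  (exists n, g = pth a n) \/ exists b x, (b << a /\ C a b /\ lvl b x) /\ node_branch lvl a b x = g.
Proof.
  intros H. unfold lvl at 1. rewrite (tree_limit H). simpl.
  split; (intros [[n ->]|]; [left; exists n|now right]); now rewrite pth_limit.
Qed.

Lemma lvl_sc b g : lvl (sc b) g <-> exists h i, lvl b h /\ i << max_omega b /\ g = app b h i.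
Proof. unfold lvl at 1. now rewrite tree_sc. Qed.

Lemma pth_sc b n : pth (sc b) n = app b (pth b n) (fin n).
Proof. unfold pth at 1. now rewrite tree_sc. Qed.

Lemma club_in_of_limit_lt a c : is_limit ltK a -> C a c -> c << a.
Proof. intros la. apply (C_club la). Qed.

(** [C a] and [C c] agree below the accumulation point [c], so both runs see the same data there and
    are glued to the same node. *)
Lemma run_acc_branch L tgt cond a c : acc ltK (C a) c ->
  fst (run L (C a) tgt cond c) = branch L tgt cond c.
Proof.
  intros H. rewrite (run_acc _ _ _ H). simpl. apply glue_ext.
  - intros x xc. symmetry. now apply acc_agree.
  - intros x _ xc. f_equal. apply run_ext with c; auto.
    intros y yc. symmetry. now apply acc_agree.
Qed.

Lemma run_count L L' D tgt tgt' cond cond' b :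
  snd (run L D tgt cond b) = snd (run L' D tgt' cond' b).
Proof.
  induction b as [b IH] using (well_founded_ind lt_wf). rewrite !run_eq. unfold run_step.
  destruct dec as [e|]; [|destruct dec; auto].
  destruct (least_spec _ e) as [(_ & l & _) _]. simpl. f_equal. now apply IH.
Qed.

(** The copying condition never fails: at the predecessor the run is already a restriction of [x],
    and a union of restrictions of [x] is one again. *)
Lemma run_node_below a b x c : is_limit ltK a -> C a c -> c <<= b ->
  fst (run lvl (C a) (fun c => res c x) (fun c _ => c <<= b) c) = res c x.
Proof.
  intros la. set (r := run _ _ _ _). induction c as [c IH] using (well_founded_ind lt_wf).
  intros Cc cb. destruct (club_in_cases _ (C_club la) Cc) as [[p Hp]|[Hc|Hc]].
  - unfold r at 1. rewrite (run_pred _ _ _ Hp). fold r. destruct Hp as (Cp & pc & _).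
    destruct dec as [|n]; auto. destruct n. split; auto.
    rewrite IH; auto; [|ord]. apply res_res. ord.
  - unfold r at 1. rewrite (run_acc _ _ _ Hc). fold r. simpl. rewrite <- glue_res.
    apply res_ext; intros y yc. unfold glue. destruct Hc as (_ & _ & _ & cof).
    destruct dec as [e|n].
    + destruct (least_spec _ e) as [(Cc' & cc' & yc') _]. rewrite IH; auto; [|ord].
      now apply res_at.
    + destruct n. destruct (cof y yc) as (z & [] & ?); eauto.
  - unfold r. now rewrite (run_first _ _ _ Hc).
Qed.

(** The clauses need one simultaneous induction: at a limit, runs step upwards by the extension
    clause and paths keep copying by the coherence clause. *)
Definition tree_ok (a : K) : Prop :=
  (forall g, lvl a g -> res a g = g) /\
  (forall g b, lvl a g -> b << a -> lvl b (res b g)) /\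
  (forall x b, lvl b x -> b << a -> exists y, lvl a y /\ res b y = x) /\
  (forall n, lvl a (pth a n)) /\
  (forall b, b << a -> cofinite (fun n => res b (pth a n) = pth b n)).

(** Choosing an extension keeps a run in the tree; these clauses handle copying and gluing. *)
Definition run_ok (a : K) (tgt : K -> K -> K) (cond : K -> nat -> Prop) : Prop :=
  (forall c m, C a c -> first_in (C a) c \/ cond c m -> lvl c (tgt c)) /\
  (forall c, acc ltK (C a) c -> lvl c (branch lvl tgt cond c)).

Lemma run_in_tree a tgt cond : is_limit ltK a -> (forall b, b << a -> tree_ok b) ->
  run_ok a tgt cond -> forall c, C a c -> lvl c (fst (run lvl (C a) tgt cond c)) /\
    forall c', C a c' -> c' << c ->
      res c' (fst (run lvl (C a) tgt cond c)) = fst (run lvl (C a) tgt cond c').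
Proof.
  intros la IHa [Ht Hacc]. set (r := run _ _ _ _). intros c.
  induction c as [c IH] using (well_founded_ind lt_wf). intros Cc.
  pose proof (club_in_of_limit_lt la Cc) as ca.
  destruct (club_in_cases _ (C_club la) Cc) as [[p Hp]|[Hc|Hc]].
  - assert (lvl c (fst (r c)) /\ res p (fst (r c)) = fst (r p)) as [h1 h2].
    { unfold r at 1 2. rewrite (run_pred _ _ _ Hp). fold r. simpl. destruct Hp as (Cp & pc & _).
      destruct (IH p pc Cp) as [Lp _]. destruct (IHa c ca) as (_ & _ & ext & _).
      destruct dec as [[h1 h2]|]; eauto.
      destruct (step_spec (lvl c) c (ext _ _ Lp pc)) as (? & ? & _); auto. }
    destruct Hp as (Cp & pc & mp). split; auto. intros c' Cc' c'c.
    destruct (mp c' Cc' c'c) as [l| ->]; auto.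
    destruct (IH p pc Cp) as [_ coh]. rewrite <- (coh c' Cc' l). apply (@res_trans p); [now left|auto].
  - assert (fst (r c) = glue (C a) (fun c => fst (r c)) c) as E.
    { unfold r at 1. now rewrite (run_acc _ _ _ Hc). }
    split; [unfold r; rewrite run_acc_branch; auto|].
    intros c' Cc' c'c. rewrite E. apply (glue_spec (C a) (fun c => fst (r c))); auto.
    + intros y Cy yc. destruct (IHa y) as [can _]; [ord|]. apply can. now apply IH.
    + intros y y' Cy yc Cy' y'y. now apply IH.
    + intros x xc. destruct Hc as (_ & _ & _ & cof). destruct (cof x xc) as (z & [] & ?); eauto.
  - split; [unfold r; rewrite (run_first _ _ _ Hc); simpl; apply (Ht c 0); auto|].
    intros c' Cc' c'c. destruct (Hc c' Cc' c'c).
Qed.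

Lemma branch_in_tree a tgt cond : is_limit ltK a -> (forall b, b << a -> tree_ok b) ->
  run_ok a tgt cond -> forall c, C a c -> res c (branch lvl tgt cond a) = fst (run lvl (C a) tgt cond c).
Proof.
  intros la IHa ok c Cc. pose proof (run_in_tree la IHa ok) as H.
  apply (glue_spec (C a) (fun c => fst (run lvl (C a) tgt cond c))); auto.
  - intros y Cy yc. destruct (IHa y) as [can _]; [ord|]. apply can. now apply H.
  - intros y y' Cy yc Cy' y'y. now apply H.
  - now apply club_in_of_limit_lt.
  - intros x xa. now apply club_in_cofinal.
Qed.

(** An accumulation point [c] of [C a] above [b] has [b] in [C c], so the branch at [c] is one of
    those put into level [c]. Up to [b] it is a restriction of [x]. *)
Lemma node_run_ok a b x : is_limit ltK a -> (forall b, b << a -> tree_ok b) ->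
  C a b -> lvl b x -> run_ok a (fun c => res c x) (fun c _ => c <<= b).
Proof.
  intros la IHa Cb Lx. pose proof (club_in_of_limit_lt la Cb) as ba.
  assert (forall c, c <<= b -> lvl c (res c x)) as Lc.
  { destruct (IHa b ba) as (can & dn & _). intros c [l| ->]; [auto|now rewrite can]. }
  split.
  - intros c m Cc [Hc|Hc]; auto. apply Lc. specialize (Hc b Cb). ord.
  - intros c Hc. destruct (classic (b << c)) as [l|l].
    + apply lvl_limit; [now apply acc_limit in Hc|right; exists b, x].
      repeat split; auto. now apply (acc_agree Hc).
    + rewrite <- (run_acc_branch _ _ _ Hc), run_node_below; auto; [apply Lc; ord|apply Hc|ord].
Qed.

(** At an accumulation point [c] the glued branch is [pth c n], by the definition of the path at
    limits. *)
Lemma path_run_ok a n : is_limit ltK a -> (forall b, b << a -> tree_ok b) ->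
  run_ok a (fun c => pth c n) (fun _ m => m < n).
Proof.
  intros la IHa. split.
  - intros c m Cc _. apply (IHa c). now apply club_in_of_limit_lt.
  - intros c Hc. fold (path_branch lvl pth c n). rewrite <- pth_limit by now apply acc_limit in Hc.
    apply (IHa c). apply club_in_of_limit_lt; auto. apply Hc.
Qed.

(* Past [b0] and counter [k0] the run no longer copies, hence it tries to meet the guessed set. *)
Lemma limit_node_run a y : is_limit ltK a -> (forall b, b << a -> tree_ok b) -> lvl a y ->
  exists tgt cond b0 k0,
    y = branch lvl tgt cond a /\ run_ok a tgt cond /\
    b0 << a /\ (forall b m, b0 << b -> k0 <= m -> ~ cond b m).
Proof.
  intros la IHa Ly.
  apply (lvl_limit _ la) in Ly as [[n ->]|(b & x & (ba & Cb & Lx) & <-)].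
  - exists (fun c => pth c n), (fun _ m => m < n), zero, n.
    split; [now apply pth_limit|split; [now apply path_run_ok|]].
    split; [destruct la as [[z ?] _]; pose proof (zero_le z); ord|intros; lia].
  - exists (fun c => res c x), (fun c _ => c <<= b), b, 0.
    split; [reflexivity|split; [now apply node_run_ok|split; [auto|intros; ord]]].
Qed.

Lemma cofinite_and (P Q : nat -> Prop) : cofinite P -> cofinite Q -> cofinite (fun n => P n /\ Q n).
Proof.
  intros [l Hl] [l' Hl']. exists (l ++ l'). intros n H. apply in_or_app.
  apply not_and_or in H as [|]; auto.
Qed.

Lemma cofinite_impl (P Q : nat -> Prop) : (forall n, P n -> Q n) -> cofinite P -> cofinite Q.
Proof. intros H [l Hl]. exists l; auto. Qed.

Lemma cofinite_gt m : cofinite (fun n => m < n).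
Proof. exists (seq 0 (S m)). intros n H. apply in_seq. lia. Qed.

Lemma cofinite_all (P : nat -> Prop) : (forall n, P n) -> cofinite P.
Proof. intros H. exists nil. intros n nP. destruct (nP (H n)). Qed.

(* The counter does not depend on [n], so almost all of the paths still copy [pth] at a given level. *)
Lemma run_path_cofinite a c : is_limit ltK a -> (forall b, b << a -> tree_ok b) -> C a c ->
  cofinite (fun n => fst (run lvl (C a) (fun c => pth c n) (fun _ m => m < n) c) = pth c n).
Proof.
  intros la IHa. induction c as [c IH] using (well_founded_ind lt_wf). intros Cc.
  destruct (club_in_cases _ (C_club la) Cc) as [[p Hp]|[Hc|Hc]].
  - pose proof Hp as (Cp & pc & _).
    destruct (IHa c (club_in_of_limit_lt la Cc)) as (_ & _ & _ & _ & coh).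
    (* Copying succeeds at [c] if it did at [p], [pth c n] extends [pth p n], and [n] exceeds the
       counter; each fails for only finitely many [n]. *)
    set (m := snd (run lvl (C a) (fun c => pth c 0) (fun _ m => m < 0) p)).
    eapply cofinite_impl; [|exact (cofinite_and (IH p pc Cp) (cofinite_and (coh p pc) (cofinite_gt m)))].
    intros n (h1 & h2 & h3). rewrite (run_pred _ _ _ Hp). simpl.
    destruct dec as [|no]; auto. destruct no. split; [|congruence].
    unfold m in h3. erewrite run_count. exact h3.
  - apply cofinite_all; intros n. rewrite run_acc_branch by auto. symmetry. apply pth_limit.
    now apply acc_limit in Hc.
  - apply cofinite_all; intros n. now rewrite run_first.
Qed.

Lemma res_app b g i : res b g = g -> res b (app b g i) = g.
Proof.
  intros <-. apply functional_extensionality; intros x. unfold res, app.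
  destruct (dec (x << b)); auto. destruct (dec (x = b)); auto. ord.
Qed.

Lemma res_sc_app b g i : res b g = g -> res (sc b) (app b g i) = app b g i.
Proof.
  intros <-. apply functional_extensionality; intros x. unfold res, app.
  pose proof (lt_sc b).
  destruct (dec (x << sc b)), (dec (x = b)), (dec (x << b)); auto; exfalso; ord.
Qed.

Lemma tree_ok_all a : tree_ok a.
Proof.
  induction a as [a IH] using (well_founded_ind lt_wf).
  destruct (ordinal_cases a) as [->|[[b ->]|la]].
  - assert (forall b, ~ b << zero) as n by (intros b ?; pose proof (zero_le b); ord).
    unfold tree_ok. rewrite lvl_zero. repeat split; try (intros; exfalso; eapply n; eauto; fail).
    + intros g ->. unfold res. apply functional_extensionality; intros x. now destruct dec.
    + apply pth_zero.
  - pose proof (lt_sc b) as bs. destruct (IH b bs) as (can & dn & ext & Lp & coh).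
    assert (forall c g h i, res b g = g -> c << sc b -> h = app b g i -> res c h = res c g) as Hres.
    { intros c g h i E cb ->. apply lt_sc_le in cb. apply (@res_trans b); auto. now apply res_app. }
    split; [|split; [|split; [|split]]].
    + intros g Lg. apply lvl_sc in Lg as (h & i & Lh & _ & ->). apply res_sc_app; auto.
    + intros g c Lg cb. apply lvl_sc in Lg as (h & i & Lh & _ & ->).
      erewrite Hres; [|exact (can h Lh)|auto|reflexivity].
      apply lt_sc_le in cb as [l| ->]; auto. now rewrite can.
    + assert (forall x, lvl b x -> lvl (sc b) (app b x zero) /\ res b (app b x zero) = x) as H.
      { intros x Lx. split; [|apply res_app; auto]. apply lvl_sc. exists x, zero. split; auto.
        split; auto. apply lt_max_omega. left; exact (fin_lt_omega 0). }
      intros x c Lx cb. apply lt_sc_le in cb as [l| ->]; [|eauto].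
      destruct (ext x c Lx l) as (y & Ly & <-). destruct (H y Ly) as [h1 h2].
      eexists; split; [exact h1|]. apply (@res_trans b); [now left|auto].
    + intros n. rewrite pth_sc. apply lvl_sc. exists (pth b n), (fin n). split; auto. split; auto.
      apply lt_max_omega. left; apply fin_lt_omega.
    + intros c cb. assert (forall n, res c (pth (sc b) n) = res c (pth b n)) as E.
      { intros n. rewrite pth_sc. eapply Hres; eauto. }
      apply lt_sc_le in cb as [l| ->].
      * eapply cofinite_impl; [|exact (coh c l)]. intros n. simpl. now rewrite E.
      * apply cofinite_all; intros n. rewrite E. auto.
  - split; [|split; [|split; [|split]]].
    + intros g Lg. destruct (limit_node_run _ la IH Lg) as (tgt & cond & _ & _ & -> & _).
      apply glue_res.
    + intros g b Lg ba.
      destruct (limit_node_run _ la IH Lg) as (tgt & cond & _ & _ & -> & ok & _).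
      destruct (club_in_cofinal la ba) as (c & Cc & ca & bc).
      rewrite (res_trans (or_introl bc) (branch_in_tree la IH ok Cc)).
      apply (IH c ca); auto. now apply run_in_tree.
    + intros x b Lx ba. destruct (club_in_cofinal la ba) as (c & Cc & ca & bc).
      (* Since [b] may lie outside [C a], [x] is first extended to a level [c] of [C a], and the
         branch is generated from there. *)
      destruct (IH c ca) as (canc & _ & ext & _). destruct (ext x b Lx bc) as (x' & Lx' & <-).
      exists (node_branch lvl a c x'). split.
      { apply lvl_limit; auto. right; exists c, x'. auto. }
      apply (@res_trans c); [left; auto|]. rewrite <- (canc _ Lx') at 2.
      unfold node_branch. rewrite (branch_in_tree la IH (node_run_ok _ la IH Cc Lx') Cc).
      apply run_node_below; auto. now right.
    + intros n. apply lvl_limit; eauto.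
    + intros b ba. destruct (club_in_cofinal la ba) as (c & Cc & ca & bc).
      destruct (IH c ca) as (_ & _ & _ & _ & coh).
      eapply cofinite_impl; [|exact (cofinite_and (coh b bc) (run_path_cofinite la IH Cc))].
      intros n (h1 & h2). rewrite <- h1. apply (@res_trans c); [left; auto|]. rewrite <- h2.
      rewrite pth_limit by auto. exact (branch_in_tree la IH (path_run_ok n la IH) Cc).
Qed.

(** * Sizes of the levels *)

Lemma covered_empty {X : Type} (x0 : X) a (P : X -> Prop) : (forall x, ~ P x) -> covered a P.
Proof. intros H. exists (fun _ => x0). intros x Px. destruct (H x Px). Qed.

Lemma covered_or {X : Type} (x0 : X) a (P Q : X -> Prop) : omega <<= a ->
  covered a P -> covered a Q -> covered a (fun x => P x \/ Q x).
Proof.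
  intros wa HP HQ. pose proof (fin_lt_omega 0) as h0. pose proof (fin_lt_omega 1) as h1.
  pose proof (@fin_inj 0 1) as h01. simpl in *.
  assert (covered a (fun p => fst p << a /\ if dec (fst p = zero) then P (snd p) else Q (snd p))) as H.
  { apply (covered_union x0 (fun i x => if dec (i = zero) then P x else Q x) wa).
    intros i _. now destruct dec. }
  apply covered_mono with (1 := or_intror eq_refl) (3 := covered_image snd H).
  intros x [Px|Qx].
  - exists (zero, x). simpl. destruct dec; [|congruence]. split; auto. split; [ord|auto].
  - exists (sc zero, x). simpl. destruct dec as [e|]; [symmetry in e; discriminate (h01 e)|].
    split; auto. split; [ord|auto].
Qed.

Lemma covered_range {X : Type} a (F : nat -> X) : omega <<= a -> covered a (fun x => exists n, x = F n).
Proof.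
  intros wa. exists (fun j => F (epsilon (inhabits 0) (fun n => fin n = j))).
  intros x [n ->]. pose proof (fin_lt_omega n). exists (fin n). split; [ord|]. f_equal.
  apply fin_inj. apply (epsilon_spec (inhabits 0) (fun m => fin m = fin n)). eauto.
Qed.

Lemma covered_below a : (forall b, b << a -> covered (max_omega b) (lvl b)) ->
  covered (max_omega a) (fun p => fst p << a /\ lvl (fst p) (snd p)).
Proof.
  intros H.
  apply covered_mono with (1 := or_intror eq_refl) (P := fun p =>
    fst p << max_omega a /\ (fst p << a /\ lvl (fst p) (snd p))).
  { intros p [pa Lp]. repeat split; auto. apply lt_max_omega; auto. }
  apply (covered_union (fun x => x) (fun i x => i << a /\ lvl i x) (omega_le_max a)).
  intros i _. destruct (classic (i << a)) as [ia|ia].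
  - apply covered_mono with (1 := max_omega_mono (or_introl ia)) (3 := H i ia). tauto.
  - apply covered_empty; [exact (fun x => x)|tauto].
Qed.

(** A successor node is a pair of a node and a value; a limit level has countably many path nodes
    and at most one branch per earlier node. *)
Lemma lvl_covered a : covered (max_omega a) (lvl a).
Proof.
  induction a as [a IH] using (well_founded_ind lt_wf).
  destruct (ordinal_cases a) as [->|[[b ->]|la]].
  - rewrite lvl_zero. exists (fun _ _ => zero). intros x ->. exists zero; split; auto.
    apply lt_max_omega; left; exact (fin_lt_omega 0).
  - pose proof (lt_sc b) as bs. destruct (IH b bs) as [e He].
    destruct (covered_pairs (omega_le_max b)) as [c Hc].
    apply covered_mono with (1 := max_omega_mono (or_introl bs)) (P := lvl (sc b)); auto.
    exists (fun j => app b (e (fst (c j))) (snd (c j))). intros g Lg.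
    apply lvl_sc in Lg as (h & i & Lh & ib & ->). destruct (He h Lh) as (k & kb & <-).
    destruct (Hc (k, i)) as (j & jb & E); auto. exists j. now rewrite E.
  - apply covered_mono with (1 := or_intror eq_refl) (P := fun g => (exists n, g = pth a n) \/
      exists p, (fst p << a /\ lvl (fst p) (snd p)) /\ node_branch lvl a (fst p) (snd p) = g).
    + intros g Lg. apply lvl_limit in Lg as [|(b & x & (? & ? & ?) & ?)]; auto.
      right; exists (b, x); auto.
    + pose proof (omega_le_max a).
      apply covered_or; [exact (fun x => x)|auto|now apply covered_range|].
      apply (covered_image (fun p => node_branch lvl a (fst p) (snd p))). now apply covered_below.
Qed.

(** * Sealing *)

Lemma club_in_next a p : is_limit ltK a -> C a p -> exists n, C a n /\ pred_in (C a) n p.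
Proof.
  intros la Cp. destruct (club_in_cofinal la (club_in_of_limit_lt la Cp)) as (z & Cz & _ & pz).
  destruct (least_spec (fun x => C a x /\ p << x)) as [[Cn pn] mn]; [eauto|].
  set (n := least _) in *. exists n. split; auto. split; auto. split; auto.
  intros x Cx xn. apply NNPP; intros ?. assert (n <<= x) by (apply mn; split; auto; ord). ord.
Qed.

Hypothesis C_guess : forall A, cofinal ltK A -> stationary ltK (fun a => pos ltK a ->
  sup_eq ltK (fun b => C a b /\ (forall x, succ_omega ltK (setminus_ord ltK (C a) b) x -> A x)) a).
Hypothesis Z_guess : forall X, stationary ltK (fun a => forall x, Z a x <-> (X x /\ x << a)).

(** Diamond is applied at a point above all pairs of the graph, where the guess is the entire graph.
    The closed points of the constant function [b] are such points. *)
Lemma exists_code a g : exists d, codes d a g.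
Proof.
  destruct (bounded_image a (fun y => godel (y, g y))) as [b Hb].
  destruct (Z_guess (fun x => exists y, y << a /\ godel (y, g y) = x)
    (@club_closed_points (fun _ => b))) as (d & [[y yd] Hd] & E).
  exists d. intros x. rewrite E. split; [tauto|]. intros (z & za & <-). split; [eauto|].
  pose proof (Hb z za). pose proof (Hd y yd). ord.
Qed.

Lemma codes_ext d a g h : codes d a g -> (forall x, x << a -> g x = h x) -> codes d a h.
Proof.
  intros H E x. unfold codes in H. rewrite H.
  split; intros (y & ya & e); exists y; split; auto; rewrite <- e, E; auto.
Qed.

Lemma codes_inj d a b g h : codes d a g -> codes d b h -> a = b /\ res a g = res a h.
Proof.
  assert (forall a b g h, codes d a g -> codes d b h -> forall x, x << a -> x << b /\ g x = h x) as H.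
  { intros a' b' g' h' Hg Hh x xa. assert (Z d (godel (x, g' x))) as z by (apply Hg; eauto).
    apply Hh in z as (y & yb & e). apply godel_inj in e. injection e as -> e. auto. }
  intros Hg Hh. pose proof (H _ _ _ _ Hg Hh) as h1. pose proof (H _ _ _ _ Hh Hg) as h2. split.
  - destruct (lt_total a b) as [l|[l|l]]; auto.
    + destruct (h2 a l). ord.
    + destruct (h1 b l). ord.
  - apply res_ext. intros x xa. now apply h1.
Qed.

(** The hypothesis is density of [D]; the conclusion confines antichains to levels below [a] and
    stops branches at [a]. *)
Lemma seal (D : K -> (K -> K) -> Prop) :
  (forall a x, lvl a x -> exists b y, a <<= b /\ lvl b y /\ D b y /\ res a y = x) ->
  exists a, forall y, lvl a y -> exists b, b << a /\ D b (res b y).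
Proof.
  intros dense.
  (* For each node of level [a], [F a] exceeds the level of some extension in [D] as well as some
     code of the node. Such a bound exists because level [a] is covered. *)
  assert (exists F : K -> K, forall a x, lvl a x ->
    (exists b y, b << F a /\ a <<= b /\ lvl b y /\ D b y /\ res a y = x) /\
    (exists d, d << F a /\ codes d a x)) as [F HF].
  { apply (choice (fun a c => forall x, lvl a x ->
      (exists b y, b << c /\ a <<= b /\ lvl b y /\ D b y /\ res a y = x) /\
      (exists d, d << c /\ codes d a x))).
    intros a. destruct (choice _ (exists_code a)) as [code Hcode].
    assert (exists h : (K -> K) -> K, forall x, lvl a x ->
      exists y, a <<= h x /\ lvl (h x) y /\ D (h x) y /\ res a y = x) as [h Hh].
    { apply (choice (fun x b => lvl a x -> exists y, a <<= b /\ lvl b y /\ D b y /\ res a y = x)).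
      intros x. destruct (classic (lvl a x)) as [Lx|]; [|exists a; tauto].
      destruct (dense a x Lx) as (b & y & ?); eauto. }
    destruct (covered_bounded h (lvl_covered a)) as [b1 Hb1].
    destruct (covered_bounded code (lvl_covered a)) as [b2 Hb2].
    destruct (upper2 b1 b2) as (c & c1 & c2). exists c. intros x Lx. split.
    - destruct (Hh x Lx) as (y & ?). exists (h x), y. split; auto. pose proof (Hb1 x Lx). ord.
    - exists (code x). split; auto. pose proof (Hb2 x Lx). ord. }
  set (X := fun d => exists a y, lvl a y /\ D a y /\ codes d a y).
  set (A := fun b => E_closed F b /\ forall d, Z b d <-> X d /\ d << b).
  assert (cofinal ltK A) as cofA.
  (* Points closed under [G] are closed under [F] and lie above [b0]. *)
  { intros b0. destruct (choice _ (fun x => upper2 (F x) b0)) as [G HG].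
    destruct (Z_guess X (club_closed_points G)) as (b & [[y yb] Hb] & E). exists b.
    split; [split; [split; [exists y; auto|]|exact E]|].
    - intros x xb. pose proof (Hb x xb). destruct (HG x). ord.
    - pose proof (Hb y yb). destruct (HG y). ord. }
  assert (forall b p g, A b -> p << b -> lvl p g -> exists c, c << b /\ D c (res c (step (lvl b) b p g)))
    as stepD.
  { intros b p g [[_ Fb] Zb] pb Lg.
    destruct (tree_ok_all b) as (_ & _ & ext & _).
    destruct (step_spec (lvl b) b (ext g p Lg pb)) as (_ & _ & Hs).
    destruct Hs as (d & a & Zd & ab & cd).
    (* A candidate exists: by closure under [F], some extension of [g] in [D] has both its level and
       a code below [b], and it extends further to level [b]. *)
    - destruct (HF p g Lg) as ((c & y & cF & pc & Ly & Dy & E) & _).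
      pose proof (Fb p pb). assert (c << b) as cb by ord.
      destruct (HF c y Ly) as (_ & d & dF & Hd). pose proof (Fb c cb).
      destruct (ext y c Ly cb) as (y' & Ly' & Ey). exists y'. split; auto. split.
      + rewrite <- E, <- Ey. symmetry. now apply res_res.
      + exists d, c. split; [apply Zb; split; [exists c, y; auto|ord]|split; auto].
        apply (codes_ext _ Hd). intros x xc. rewrite <- Ey. now apply res_at.
    (* Conversely, a code in [Z b] belongs to a member of [D], and codes determine sequences, so
       hitting the guess means meeting [D]. *)
    - apply Zb in Zd as [(c & y & Ly & Dy & Hc) _]. exists c.
      destruct (codes_inj Hc cd) as [-> E]. split; auto.
      rewrite <- E. destruct (tree_ok_all a) as [can _]. now rewrite can. }
  (* Closure under [sc] makes [a] a limit. *)
  destruct (C_guess cofA (club_closed_points sc)) as (a & [pa sa] & Ha). specialize (Ha pa).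
  assert (is_limit ltK a) as la.
  { split; auto. intros b ba. exists (sc b). split; [apply lt_sc|auto]. }
  exists a. intros y Ly.
  destruct (limit_node_run y la (fun b _ => tree_ok_all b) Ly)
    as (tgt & cond & b0 & k0 & -> & ok & b0a & late).
  set (r := run lvl (C a) tgt cond).
  destruct Ha as [_ Ha]. destruct (Ha b0 b0a) as (b & [Cb Hb] & b0b). clear Ha.
  (* After [k] steps from [b] the counter is at least [k] and only finitely many elements have been
     passed, so the next one is in [succ_omega (setminus_ord (C a) b)]. *)
  assert (forall k, exists c, C a c /\ b <<= c /\ k <= snd (r c) /\
    exists l, forall x, C a x -> b <<= x -> x << c -> In x l) as chain.
  { induction k as [|k (c & Cc & bc & kc & l & Hl)].
    - exists b. split; auto. split; [now right|]. split; [lia|]. exists nil. intros; ord.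
    - destruct (club_in_next la Cc) as (n & Cn & Hp). exists n. pose proof (proj1 (proj2 Hp)) as cn.
      split; auto. split; [ord|]. split.
      + unfold r. rewrite (run_pred _ _ _ Hp). fold r. simpl. lia.
      + exists (c :: l). intros x Cx bx xn. destruct Hp as (_ & _ & Hp).
        destruct (Hp x Cx xn) as [|<-]; simpl; auto. }
  destruct (chain k0) as (p & Cp & bp & kp & l & Hl).
  destruct (club_in_next la Cp) as (n & Cn & Hp). pose proof (proj1 (proj2 Hp)) as pn.
  assert (A n) as An.
  { apply Hb. split; [split; [auto|ord]|]. split.
    - exists b. split; [split; [auto|apply lt_irrefl]|ord].
    - exists (p :: l). intros x [[Cx xb] xn]. destruct Hp as (_ & _ & Hp).
      destruct (Hp x Cx xn) as [|<-]; simpl; auto. right. apply Hl; auto. ord. }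
  destruct (stepD n p (fst (r p)) An pn) as (c & cn & Dc).
  { now apply (run_in_tree la (fun b _ => tree_ok_all b) ok). }
  exists c. split; [pose proof (club_in_of_limit_lt la Cn); ord|].
  rewrite (res_trans (or_introl cn) (branch_in_tree la (fun b _ => tree_ok_all b) ok Cn)).
  rewrite (run_pred _ _ _ Hp). fold r. simpl. destruct dec as [[h _]|]; auto.
  destruct (late n (snd (r p))); auto. ord.
Qed.
(** * Nodes *)

(** Nodes have dependent domains; this passage turns their comparison into equations between
    functions on [K]. *)
Definition seq_of (t : node ltK) : K -> K := fun x =>
  match dec (x << height t) with left h => projT2 t (exist _ x h) | right _ => zero end.

Definition node_of (a : K) (g : K -> K) : node ltK := existT _ a (fun s => g (proj1_sig s)).

Lemma seq_of_node_of a g : seq_of (node_of a g) = res a g.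
Proof. apply functional_extensionality; intros x. unfold seq_of, res; simpl. now destruct dec. Qed.

Lemma seq_of_at t x (h : x << height t) : seq_of t x = projT2 t (exist _ x h).
Proof. unfold seq_of. destruct dec as [h'|]; [|contradiction]. now rewrite (proof_irrelevance _ h h'). Qed.

Lemma node_eq t u : height t = height u -> seq_of t = seq_of u -> t = u.
Proof.
  intros e E.
  assert (forall x h1 h2, projT2 t (exist _ x h1) = projT2 u (exist _ x h2)) as H.
  { intros x h1 h2. rewrite <- !seq_of_at. now rewrite E. }
  destruct t as [a g], u as [b g']; simpl in *. destruct e. f_equal.
  apply functional_extensionality; intros [x h]. apply H.
Qed.

Lemma psub_iff t u : psub t u <-> height t << height u /\ res (height t) (seq_of u) = seq_of t.
Proof.
  split; intros [l H]; split; auto.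
  - apply functional_extensionality; intros x. unfold res, seq_of at 2.
    destruct dec as [h|]; auto. assert (x << height u) as h' by ord.
    rewrite (seq_of_at u h'). symmetry. apply H.
  - intros x h1 h2. rewrite <- !seq_of_at, <- H. now apply res_at.
Qed.

Definition tree_nodes (t : node ltK) : Prop := lvl (height t) (seq_of t).

Lemma tree_nodes_node_of a g : lvl a g -> tree_nodes (node_of a g).
Proof.
  intros Lg. unfold tree_nodes. rewrite seq_of_node_of. simpl.
  destruct (tree_ok_all a) as [can _]. now rewrite can.
Qed.

Lemma tree_downward_closed : downward_closed tree_nodes.
Proof.
  intros t u Tu tu. apply psub_iff in tu as [l E]. unfold tree_nodes. rewrite <- E.
  destruct (tree_ok_all (height u)) as (_ & dn & _). now apply dn.
Qed.

Lemma tree_prolific : prolific tree_nodes.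
Proof.
  intros a x Tx ha i Hi.
  assert (res a (seq_of x) = seq_of x) as can by (rewrite <- ha; now apply tree_ok_all).
  exists (node_of (sc a) (app a (seq_of x) i)). split.
  - apply tree_nodes_node_of, lvl_sc. exists (seq_of x), i. split; [rewrite <- ha; exact Tx|split; auto].
    apply lt_max_omega. now rewrite <- lt_omega_iff.
  - split; [|split].
    + rewrite ha. split; [apply lt_sc|]. intros g ag ga. apply lt_sc_le in ga. ord.
    + apply psub_iff. rewrite ha. split; [apply lt_sc|].
      rewrite seq_of_node_of, res_res by (left; apply lt_sc). now apply res_app.
    + assert (height x << sc a) as h by (rewrite ha; apply lt_sc).
      exists h. simpl. unfold app. destruct dec; congruence.
Qed.

Lemma level_index a : exists idx : level tree_nodes a -> K,
  (forall t, idx t << max_omega a) /\ (forall t u, idx t = idx u -> t = u).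
Proof.
  destruct (lvl_covered a) as [e He].
  destruct (choice (fun (t : level tree_nodes a) j => j << max_omega a /\ e j = seq_of (proj1_sig t)))
    as [idx Hidx].
  { intros [t [Tt <-]]. simpl. exact (He _ Tt). }
  exists idx. split; [apply Hidx|]. intros t u E. apply sig_inj.
  destruct (Hidx t) as [_ h1], (Hidx u) as [_ h2]. destruct t as [t [Tt et]], u as [u [Tu eu]]. simpl in *.
  apply node_eq; congruence.
Qed.

Lemma tree_slim : slim tree_nodes.
Proof.
  intros a. destruct (level_index a) as (idx & idx_lt & idx_inj).
  destruct (choice (fun t (s : seg ltK a + nat) =>
    match s with inl j => proj1_sig j = idx t | inr n => fin n = idx t end)) as [c Hc].
  { intros t. pose proof (idx_lt t) as h. apply lt_max_omega in h as [h|h].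
    - destruct (lt_omega_fin h) as [n e]. now exists (inr n).
    - now exists (inl (exist _ (idx t) h)). }
  exists c. intros t u E. apply idx_inj. pose proof (Hc t) as ht; pose proof (Hc u) as hu.
  rewrite E in ht. destruct (c u); congruence.
Qed.

(** [max_omega a] is an element of [K], and [K] embeds in none of its proper initial segments. *)
Lemma level_card_lt a : card_lt (level tree_nodes a) K.
Proof.
  destruct (level_index a) as (idx & idx_lt & idx_inj). split; [now exists idx|].
  intros H. destruct reg as (_ & ini & _ & _). apply (ini (max_omega a)). apply (card_le_trans H).
  exists (fun t => exist _ (idx t) (idx_lt t)). intros t u E. apply idx_inj. now injection E.
Qed.

Lemma tree_no_branch : ~ exists B : node ltK -> Prop,
  (forall t, B t -> tree_nodes t) /\
  (forall t u, B t -> B u -> t = u \/ psub t u \/ psub u t) /\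
  (forall a, exists t, B t /\ height t = a).
Proof.
  intros (B & BT & lin & cof).
  (* The complement of [B] is dense: appending 0 and 1 to [x] gives two nodes of the same level, and
     the chain [B] misses one. *)
  destruct (seal (fun a g => forall t, B t -> height t = a -> seq_of t <> g)) as [a Ha].
  - intros a x Lx. apply NNPP; intros no.
    assert (forall i, i << omega -> exists t, B t /\ height t = sc a /\ seq_of t = app a x i) as H.
    { intros i iw. apply NNPP; intros nt. apply no. exists (sc a), (app a x i).
      split; [left; apply lt_sc|]. split; [|split].
      - apply lvl_sc. exists x, i. split; auto. split; auto. apply lt_max_omega; auto.
      - intros t Bt et E. apply nt; eauto.
      - apply res_app. now apply tree_ok_all. }
    destruct (H (fin 0)) as (t & Bt & ht & Et); [apply fin_lt_omega|].
    destruct (H (fin 1)) as (u & Bu & hu & Eu); [apply fin_lt_omega|].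
    destruct (lin t u Bt Bu) as [e|[[l _]|[l _]]]; [|rewrite ht, hu in l; exact (lt_irrefl l)..].
    enough (fin 0 = fin 1) as e' by now apply fin_inj in e'.
    assert (app a x (fin 0) a = app a x (fin 1) a) as e' by congruence.
    unfold app in e'. destruct dec; congruence.
  - destruct (cof a) as (t & Bt & <-). destruct (Ha _ (BT t Bt)) as (b & bt & Hb).
    destruct (cof b) as (u & Bu & <-). apply (Hb u Bu eq_refl).
    destruct (lin t u Bt Bu) as [e|[[l _]|l]].
    + subst. destruct (lt_irrefl bt).
    + ord.
    + apply psub_iff in l as [_ <-]. reflexivity.
Qed.

Lemma tree_no_antichain : ~ exists A : node ltK -> Prop,
  (forall t, A t -> tree_nodes t) /\
  (forall t u, A t -> A u -> ~ psub t u) /\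
  card_le K {t | A t}.
Proof.
  intros (A & AT & anti & [phi Hphi]).
  destruct (seal (fun a g =>
    (exists x, A x /\ height x <<= a /\ res (height x) g = seq_of x) \/
    (forall x, A x -> a << height x -> res a (seq_of x) <> g))) as [a Ha].
  - intros a g Lg.
    destruct (classic (exists x, A x /\ a << height x /\ res a (seq_of x) = g)) as [(x & Ax & l & E)|n].
    + exists (height x), (seq_of x). split; [now left|]. split; [now apply AT|]. split; auto.
      left; exists x. split; auto. split; [now right|]. apply tree_ok_all. now apply AT.
    + exists a, g. split; [now right|]. split; auto. split; [|now apply tree_ok_all].
      right. intros x Ax l E. apply n; eauto.
  - assert (forall x, A x -> height x << a) as low.
    { intros x Ax. apply NNPP; intros n. assert (a <<= height x) as l by ord.
      assert (lvl a (res a (seq_of x))) as Lx.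
      { destruct (tree_ok_all (height x)) as (can & dn & _). pose proof (AT x Ax) as Tx.
        destruct l as [l| ->]; [now apply dn|]. rewrite can; auto. }
      destruct (Ha _ Lx) as (b & ba & [(x' & Ax' & l' & E)|H]).
      - apply (anti x' x Ax' Ax). apply psub_iff. split; [ord|]. rewrite <- E.
        now rewrite (res_res _ (or_introl ba)), res_res.
      - apply (H x Ax); [ord|]. symmetry. apply res_res. now left. }
    (* The nodes below [a] are enumerated by [max_omega a]; pulling back along [phi] would enumerate
       all of [K]. *)
    apply (@not_covered (max_omega a)).
    destruct (covered_below (fun b _ => lvl_covered b) (a := a)) as [e He].
    exists (fun j => epsilon (inhabits zero)
      (fun k => (height (proj1_sig (phi k)), seq_of (proj1_sig (phi k))) = e j)).
    intros k _. destruct (phi k) as [t At] eqn:Ek.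
    destruct (He (height t, seq_of t)) as (j & ja & E); [split; [now apply low|now apply AT]|].
    exists j. split; auto. rewrite E. clear E.
    match goal with |- epsilon ?i ?P = _ => assert (P (epsilon i P)) as H end.
    { apply epsilon_spec. exists k. now rewrite Ek. }
    injection H as H1 H2. apply Hphi, sig_inj. rewrite Ek. now apply node_eq.
Qed.

Lemma tree_souslin : souslin tree_nodes.
Proof.
  split; [|split; [exact level_card_lt|split; [exact tree_no_branch|exact tree_no_antichain]]].
  intros a. exists (node_of a (pth a 0)). split; [|reflexivity].
  apply tree_nodes_node_of. now apply tree_ok_all.
Qed.

Definition path_node (a : K) (n : nat) : node ltK := node_of a (pth a n).

Lemma seq_of_path_node a n : seq_of (path_node a n) = pth a n.
Proof.
  unfold path_node. rewrite seq_of_node_of. destruct (tree_ok_all a) as (can & _ & _ & Lp & _). auto.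
Qed.

Lemma path_ascent : ascent_path tree_nodes path_node.
Proof.
  split.
  - intros a n. split; [|reflexivity]. apply tree_nodes_node_of. now apply tree_ok_all.
  - intros a b ab. destruct (tree_ok_all b) as (_ & _ & _ & _ & coh).
    apply (cofinite_impl (P := fun n => res a (pth b n) = pth a n)); auto.
    intros n E. apply psub_iff. rewrite !seq_of_path_node. auto.
Qed.

Lemma path_injective : injective_path path_node.
Proof.
  (* At level one the path node [n] is the single value [fin n]. *)
  exists (sc zero), (fun _ => True). split; [now apply cofinite_all|].
  intros m n _ _ E. apply (f_equal seq_of) in E. rewrite !seq_of_path_node, !pth_sc in E.
  apply (f_equal (fun g => g zero)) in E. unfold app in E. destruct dec; [|congruence].
  now apply fin_inj.
Qed.

End Tree.

Theorem theorem4p1 (K : Type) (ltK : K -> K -> Prop) :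
  regular_uncountable_cardinal ltK ->
  P14_sq_1_kappa ltK ->
  exists T : node ltK -> Prop,
    downward_closed T /\ prolific T /\ slim T /\ souslin T /\
    exists f : K -> nat -> node ltK, ascent_path T f /\ injective_path f.
Proof.
  intros reg [(C & C_club & C_coh & C_guess) (Z & _ & Z_guess)].
  exists (tree_nodes reg C Z).
  split; [now apply tree_downward_closed|]. split; [now apply tree_prolific|].
  split; [now apply tree_slim|]. split; [now apply tree_souslin|].
  exists (path_node reg C Z). split; [now apply path_ascent|now apply path_injective].
Qed.
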